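(* For every $\epsilon>0$ and every $B>1$, there exist a natural number $M>B$ and a finite unit norm tight frame (FUNTF) $(x_i)_{1\le i\le M}$ of a finite dimensional Hilbert space such that whenever $I\subseteq\{1,\dots,M\}$ is such that $(x_i)_{i\in I}$ is a basis of that Hilbert space, the lower Riesz constant of $(x_i)_{i\in I}$ is less than $\epsilon$.
   Context: A FUNTF of a finite dimensional Hilbert space $H$ is a finite collection $(x_i)_{1\le i\le M}$ of unit vectors of $H$ that is a tight frame of $H$, i.e. there is $K>0$ with $\sum_{i=1}^M|\langle x,x_i\rangle|^2=K\|x\|^2$ for all $x\in H$. The lower Riesz constant of a finite linearly independent family $(x_i)_{i\in I}$ is the largest $a\ge0$ such that $a\sum_{i\in I}|c_i|^2\le\bigl\|\sum_{i\in I}c_ix_i\bigr\|^2$ for all scalars $(c_i)_{i\in I}$. *)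

(* Defs.v *)
From HB Require Import structures.
From mathcomp Require Import all_boot all_order all_algebra.
From mathcomp Require Import complex reals.

Set Implicit Arguments.
Unset Strict Implicit.
Unset Printing Implicit Defensive.

Import Order.TTheory GRing.Theory Num.Theory.

Local Open Scope ring_scope.

(* A finite-dimensional Hilbert space over F is a vectType over F with a
   positive definite Hermitian form [dot : {dot V for theta}]: theta is [idfun]
   for F = R and complex conjugation for F = R[i].  The form is linear in its
   first argument, [dot v v] is the squared norm of v, and over R[i] the
   inequalities [0 <= a] and [0 < a] entail that a is real. *)

Definition unit_norm (F : numFieldType) (theta : F -> F) (V : vectType F)
    (dot : {dot V for theta}) (M : nat) (x : 'I_M -> V) : Prop :=
  forall i, dot (x i) (x i) = 1.

Definition tight_frame (F : numFieldType) (theta : F -> F) (V : vectType F)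
    (dot : {dot V for theta}) (M : nat) (x : 'I_M -> V) : Prop :=
  exists2 K : F, 0 < K &
    forall v : V, \sum_(i < M) `|dot v (x i)| ^+ 2 = K * dot v v.

Definition FUNTF (F : numFieldType) (theta : F -> F) (V : vectType F)
    (dot : {dot V for theta}) (M : nat) (x : 'I_M -> V) : Prop :=
  unit_norm dot x /\ tight_frame dot x.

(* [image x I] keeps repetitions, so this is about the family (x i)_(i in I),
   not about its set of values. *)
Definition subfamily_basis (F : numFieldType) (V : vectType F) (M : nat)
    (x : 'I_M -> V) (I : {set 'I_M}) : bool :=
  basis_of {:V}%VS (image x (mem I)).

Definition lower_riesz_bound (F : numFieldType) (theta : F -> F)
    (V : vectType F) (dot : {dot V for theta}) (M : nat) (x : 'I_M -> V)
    (I : {set 'I_M}) (a : F) : Prop :=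
  0 <= a /\
  forall c : 'I_M -> F,
    a * \sum_(i in I) `|c i| ^+ 2
      <= dot (\sum_(i in I) c i *: x i) (\sum_(i in I) c i *: x i).

Definition lower_riesz_constant (F : numFieldType) (theta : F -> F)
    (V : vectType F) (dot : {dot V for theta}) (M : nat) (x : 'I_M -> V)
    (I : {set 'I_M}) (a : F) : Prop :=
  lower_riesz_bound dot x I a /\
  forall b : F, lower_riesz_bound dot x I b -> b <= a.

(* Main.v *)
Require Import Defs.
From HB Require Import structures.
From mathcomp Require Import all_boot all_order all_algebra.
From mathcomp Require Import complex reals.
From mathcomp Require Import ring zify.

Set Implicit Arguments.
Unset Strict Implicit.
Unset Printing Implicit Defensive.

Import Order.TTheory GRing.Theory Num.Theory.

Local Open Scope ring_scope.
Local Open Scope complex_scope.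

(** The frame is the regular simplex: n + 1 unit vectors in dimension n whose
    pairwise inner products all equal -1/n.  It is tight because its
    symmetry group acts irreducibly; [simplex_FUNTF] checks this by a direct
    computation.  For any family A of its vertices,
      |sum_A c_i x_i|^2 = (1 + 1/n) sum_A |c_i|^2 - (1/n) |sum_A c_i|^2.
    A basis consists of n vertices, and then Cauchy-Schwarz bounds
    |sum_A c_i|^2 by n sum_A |c_i|^2, with equality for constant c; hence the
    lower Riesz constant of every basis is exactly
    (1 + 1/n) - 1 = 1/n, which tends to 0 as n grows
    ([simplex_dot_sum], [sqr_norm_sum_le], [simplex_lower_riesz_constant]).

    To avoid the square roots of an orthonormal realization, n of the
    vertices are taken to be the standard basis of the row vectors, the
    remaining one is minus their sum, and the inner product is chosen so that the Gram
    matrix comes out right.  The real and complex cases are treated at once: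
    only an involutive automorphism theta with |z|^2 = z * theta z is used. *)

(** After the triangle inequality it remains to compare with t^2, where t is the
    sum of the |c i|; multiplied by #|A|, the difference is the sum of the
    squares of the deviations [#|A| * |c i| - t]. *)
Lemma sqr_norm_sum_le (F : numFieldType) (I : finType) (A : {pred I})
    (c : I -> F) :
  `|\sum_(i in A) c i| ^+ 2 <= #|A|%:R * \sum_(i in A) `|c i| ^+ 2.
Proof.
have [A0|m_gt0] := posnP #|A|.
  by rewrite !big_pred0 ?normr0 ?expr0n ?mulr0 // => i; apply: (card0_eq A0).
set m : F := #|A|%:R; set t := \sum_(i in A) `|c i|.
have m0 : 0 < m by rewrite ltr0n.
have t_ge0 : 0 <= t by apply: sumr_ge0.
apply: (@le_trans _ _ (t ^+ 2)); first by rewrite lerXn2r ?nnegrE ?ler_norm_sum.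
have dev_ge0 : 0 <= \sum_(i in A) (m * `|c i| - t) ^+ 2.
  apply: sumr_ge0 => i _; apply: real_exprn_even_ge0 => //.
  by rewrite rpredB ?rpredM ?ger0_real // ltW.
rewrite -subr_ge0 -(pmulr_rge0 _ m0).
suff <- : \sum_(i in A) (m * `|c i| - t) ^+ 2
   = m * (m * (\sum_(i in A) `|c i| ^+ 2) - t ^+ 2) by [].
rewrite (eq_bigr (fun i =>
  m ^+ 2 * `|c i| ^+ 2 - 2 * m * t * `|c i| + t ^+ 2)); last by move=> i _; ring.
rewrite !big_split /= sumrN -!mulr_sumr -/t sumr_const -mulr_natl -/m; ring.
Qed.

(** * The inner product *)

Section SimplexDot.

Variables (F : numFieldType) (theta : involutive_rmorphism F).
Hypothesis thetaE : forall z, `|z| ^+ 2 = z * theta z.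
Variable n : nat.
Implicit Types u v : 'rV[F]_n.

Let thetaK z : theta (theta z) = z.
Proof. exact: rmorphK. Qed.

(** The Gram matrix of the standard basis is (1 + 1/n) Id - (1/n) J, with J
    the all-ones matrix. *)
Definition simplex_form u v : F :=
  (1 + n%:R^-1) * \sum_k u 0 k * theta (v 0 k)
  - n%:R^-1 * ((\sum_k u 0 k) * theta (\sum_k v 0 k)).

Lemma simplex_form_linear v : linear_for *%R (simplex_form^~ v).
Proof.
move=> a u w; rewrite /simplex_form.
have -> : \sum_k (a *: u + w) 0 k = a * \sum_k u 0 k + \sum_k w 0 k.
  by rewrite mulr_sumr -big_split; apply: eq_bigr => k _; rewrite !mxE.
have -> : \sum_k (a *: u + w) 0 k * theta (v 0 k)
    = a * (\sum_k u 0 k * theta (v 0 k)) + \sum_k w 0 k * theta (v 0 k).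
  rewrite mulr_sumr -big_split; apply: eq_bigr => k _.
  by rewrite !mxE mulrDl mulrA.
ring.
Qed.

Lemma simplex_form_herm u v : simplex_form u v = theta (simplex_form v u).
Proof.
rewrite /simplex_form rmorphB !rmorphM rmorphD rmorph1 fmorphV rmorph_nat /=.
rewrite [in RHS]rmorph_sum thetaK [X in _ - _ * X]mulrC; congr (_ * _ - _).
by apply: eq_bigr => k _; rewrite rmorphM /= thetaK mulrC.
Qed.

(** Hermitian symmetry transfers linearity to the second argument. *)
Lemma simplex_form_semilinear u : linear_for (theta \; *%R) (simplex_form u).
Proof.
move=> a v w; rewrite simplex_form_herm simplex_form_linear rmorphD rmorphM /=.
by rewrite -!simplex_form_herm.
Qed.

Lemma simplex_form_self v :
  simplex_form v v = (1 + n%:R^-1) * (\sum_k `|v 0 k| ^+ 2)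
                     - n%:R^-1 * `|\sum_k v 0 k| ^+ 2.
Proof.
by rewrite /simplex_form thetaE; under [in RHS]eq_bigr do rewrite thetaE.
Qed.

(** By Cauchy-Schwarz the form dominates 1/n times the standard one. *)
Lemma simplex_form_gt0 v : v != 0 -> 0 < simplex_form v v.
Proof.
case/rV0Pn => k vk; have n_gt0 : (0 < n)%N by case: n k {v vk} => [[]|].
have n0 : 0 < n%:R :> F by rewrite ltr0n.
have sq_gt0 : 0 < \sum_k `|v 0 k| ^+ 2.
  rewrite (bigD1 k) //= ltr_wpDr ?sumr_ge0 // => [i _|]; first exact: exprn_ge0.
  by rewrite exprn_gt0 // normr_gt0.
apply: (@lt_le_trans _ _ (n%:R^-1 * \sum_k `|v 0 k| ^+ 2)).
  by rewrite mulr_gt0 ?invr_gt0.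
rewrite simplex_form_self lerBrDl mulrDl mul1r lerD2r.
rewrite ler_pdivrMl //.
by have := sqr_norm_sum_le 'I_n (fun k => v 0 k); rewrite card_ord.
Qed.

HB.instance Definition _ := @bilinear_isBilinear.Build F 'rV[F]_n 'rV[F]_n F
  *%R (theta \; *%R) simplex_form (simplex_form_linear, simplex_form_semilinear).

Let simplex_form_hermitian u v :
  simplex_form u v = (-1) ^+ false * theta (simplex_form v u).
Proof. by rewrite expr0 mul1r simplex_form_herm. Qed.

HB.instance Definition _ := @isHermitianSesquilinear.Build F 'rV[F]_n false
  theta simplex_form simplex_form_hermitian.

HB.instance Definition _ :=
  @isDotProduct.Build F 'rV[F]_n simplex_form simplex_form_gt0.

Definition simplex_dot : {dot 'rV[F]_n for theta} := simplex_form.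

(** * The vertices and their Riesz constants *)

Definition simplex (i : 'I_n.+1) : 'rV[F]_n :=
  if unlift ord0 i is Some k then delta_mx 0 k else const_mx (-1).

(** Coefficients expressing v through the n + 1 vertices, with weight 0 on the
    vertex [ord0]; they give the inner products of v with all vertices, [ord0]
    included, by the single formula [simplex_dot_vertex]. *)
Definition simplex_coord v (i : 'I_n.+1) : F :=
  if unlift ord0 i is Some k then v 0 k else 0.

Lemma sum_simplex_coord (f : F -> F) v :
  f 0 = 0 -> \sum_i f (simplex_coord v i) = \sum_k f (v 0 k).
Proof.
move=> f0; rewrite big_ord_recl /simplex_coord unlift_none f0 add0r.
by apply: eq_bigr => k _; rewrite liftK.
Qed.

Let sum_delta_mx k : \sum_j (delta_mx 0 k : 'rV[F]_n) 0 j = 1.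
Proof.
rewrite (bigD1 k) //= big1 => [|j jk]; last by rewrite mxE (negPf jk) andbF.
by rewrite mxE !eqxx addr0.
Qed.

Hypothesis n_gt0 : (0 < n)%N.

Let mulVn : n%:R^-1 * n%:R = 1 :> F.
Proof. by rewrite mulVf // pnatr_eq0 -lt0n. Qed.

Lemma simplex_dot_vertex v i :
  simplex_dot v (simplex i)
  = (1 + n%:R^-1) * simplex_coord v i - n%:R^-1 * \sum_k v 0 k.
Proof.
rewrite /simplex_dot /= /simplex_form /simplex /simplex_coord.
case: unliftP => [k _|_].
  congr (_ * _ - _ * _).
    rewrite (bigD1 k) //= big1 => [|j jk]; last first.
      by rewrite mxE (negPf jk) andbF rmorph0 mulr0.
    by rewrite mxE !eqxx rmorph1 mulr1 addr0.
  by rewrite sum_delta_mx rmorph1 mulr1.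
set s := \sum_k v 0 k.
have -> : \sum_k v 0 k * theta ((const_mx (-1) : 'rV[F]_n) 0 k) = - s.
  by rewrite -sumrN; apply: eq_bigr => k _; rewrite mxE rmorphN1 mulrN1.
have -> : \sum_k (const_mx (-1) : 'rV[F]_n) 0 k = - n%:R.
  by under eq_bigr do rewrite mxE; rewrite sumr_const card_ord mulNrn.
rewrite rmorphN rmorph_nat mulr0 add0r.
have nV := mulVn; by ring: nV.
Qed.

Lemma simplex_gram i j :
  simplex_dot (simplex i) (simplex j)
  = (1 + n%:R^-1) * (i == j)%:R - n%:R^-1.
Proof.
rewrite simplex_dot_vertex /simplex_coord /simplex.
case: (unliftP ord0 i) => [k ->|->].
  rewrite sum_delta_mx mulr1; congr (_ * _ - _).
  case: (unliftP ord0 j) => [l ->|->]; last first.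
    by rewrite eq_sym (negPf (neq_lift _ _)).
  by rewrite mxE (inj_eq lift_inj) eqxx eq_sym.
under [\sum_k _]eq_bigr do rewrite mxE.
rewrite sumr_const card_ord mulNrn mulrN mulVn opprK.
case: (unliftP ord0 j) => [l ->|->]; last by rewrite eqxx /=; ring.
by rewrite mxE (negPf (neq_lift _ _)) mulr0n; ring.
Qed.

(** By [simplex_dot_vertex], |<v, x_i>|^2 expands as a quadratic expression in
    the i-th coordinate of v and the sum s of all coordinates.  Summing over i
    collects the terms in |s|^2 with coefficient
    - 2 (1 + q) q + (n + 1) q^2 = - (1 + q) q for q = 1/n, which leaves
    (1 + q) <v, v>: the frame constant is 1 + 1/n. *)
Lemma simplex_FUNTF : FUNTF simplex_dot simplex.
Proof.
split=> [i|]; first by rewrite simplex_gram eqxx mulr1 addrK.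
exists (1 + n%:R^-1) => [|v]; first by rewrite addr_gt0 ?invr_gt0 ?ltr0n.
set q := n%:R^-1; set s := \sum_k v 0 k.
have term i : `|simplex_dot v (simplex i)| ^+ 2
    = (1 + q) ^+ 2 * `|simplex_coord v i| ^+ 2
      - (1 + q) * q * (simplex_coord v i * theta s)
      - (1 + q) * q * s * theta (simplex_coord v i) + q ^+ 2 * s * theta s.
  rewrite simplex_dot_vertex -/s -/q !thetaE.
  rewrite rmorphB !rmorphM rmorphD rmorph1 /q fmorphV rmorph_nat; ring.
rewrite (eq_bigr _ (fun i _ => term i)) !big_split /= !sumrN -!mulr_sumr.
rewrite -mulr_suml sumr_const card_ord.
rewrite (sum_simplex_coord (f := fun z => `|z| ^+ 2)) ?normr0 ?expr0n //.
rewrite (sum_simplex_coord (f := id)) //.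
rewrite (sum_simplex_coord (f := theta)) ?rmorph0 //.
rewrite -rmorph_sum -/s simplex_form_self -/q -/s !thetaE -mulr_natr -natr1.
have qn : q * n%:R = 1 := mulVn.
ring: qn.
Qed.

Lemma simplex_dot_sum (A : {set 'I_n.+1}) (c : 'I_n.+1 -> F) :
  simplex_dot (\sum_(i in A) c i *: simplex i) (\sum_(i in A) c i *: simplex i)
  = (1 + n%:R^-1) * (\sum_(i in A) `|c i| ^+ 2)
    - n%:R^-1 * `|\sum_(i in A) c i| ^+ 2.
Proof.
rewrite linear_sumlz thetaE mulr_suml !mulr_sumr -sumrB; apply: eq_bigr => i Ai.
rewrite linearZl_LR /= linear_sumr.
have dotZ j : simplex_dot (simplex i) (c j *: simplex j)
    = theta (c j) * ((1 + n%:R^-1) * (i == j)%:R) - theta (c j) * n%:R^-1.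
  by rewrite linearZr_LR /= simplex_gram mulrBr.
rewrite (eq_bigr _ (fun j _ => dotZ j)).
rewrite sumrB (bigD1 i) //= big1 => [|j /andP[_ ji]]; last first.
  by rewrite eq_sym (negPf ji) !mulr0.
rewrite eqxx thetaE -mulr_suml rmorph_sum /=; set t := \sum_(j in A) _.
ring.
Qed.

(** Cardinality is all that matters: [A] has n elements because it indexes a
    basis of an n-dimensional space.  Cauchy-Schwarz makes 1/n a lower bound;
    testing any other bound b on c = 1 gives b n <= (1 + 1/n) n - n = 1. *)
Lemma simplex_lower_riesz_constant (A : {set 'I_n.+1}) :
  subfamily_basis simplex A ->
  lower_riesz_constant simplex_dot simplex A n%:R^-1.
Proof.
move=> basisA; have cardA : #|A| = n.
  have := size_basis (X := in_tuple _) basisA.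
  by rewrite dimvf dim_matrix size_image mul1r.
have q0 : 0 < n%:R^-1 :> F by rewrite invr_gt0 ltr0n.
split; [split; first exact: ltW|] => [c|b [_ /(_ (fun=> 1))]].
  rewrite simplex_dot_sum lerBrDl mulrDl mul1r lerD2r.
  by have := sqr_norm_sum_le A c; rewrite cardA ler_pdivrMl ?ltr0n.
rewrite simplex_dot_sum normr1 expr1n !sumr_const cardA normr_nat.
rewrite [X in _ <= X](_ : _ = 1); last first.
  rewrite mulrDl mul1r mulVn expr2 mulrA mulVn; ring.
by rewrite -[n%:R^-1]div1r ler_pdivlMr ?ltr0n.
Qed.

End SimplexDot.

Theorem theorem3p7 (R : realType) (eps B : R) (heps : 0 < eps) (hB : 1 < B) :
  (exists M : nat, B < M%:R /\
   exists (V : vectType R) (dot : {dot V for idfun}) (x : 'I_M -> V),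
     FUNTF dot x /\
     forall I : {set 'I_M}, subfamily_basis x I ->
       exists a : R, lower_riesz_constant dot x I a /\ a < eps)
  /\
  (exists M : nat, B < M%:R /\
   exists (V : vectType R[i]) (dot : {dot V for Num.conj}) (x : 'I_M -> V),
     FUNTF dot x /\
     forall I : {set 'I_M}, subfamily_basis x I ->
       exists a : R[i], lower_riesz_constant dot x I a /\ a < eps%:C).
Proof.
pose n := (Num.bound B + Num.bound eps^-1).+1.
have n_gt0 : (0 < n)%N by [].
have B_ltM : B < n.+1%:R.
  have /ltW B0 : 0 < B := lt_trans ltr01 hB.
  by apply: (lt_le_trans (archi_boundP B0)); rewrite ler_nat /n; lia.
have eps_gt : n%:R^-1 < eps.
  rewrite invf_plt ?posrE ?ltr0n //.
  have e0 : 0 <= eps^-1 by rewrite invr_ge0 ltW.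
  apply: (lt_le_trans (archi_boundP e0)); rewrite ler_nat /n; lia.
split; exists n.+1; split=> //.
- have thetaE (z : R) : `|z| ^+ 2 = z * (idfun : involutive_rmorphism R) z.
    by rewrite real_normK ?num_real.
  exists 'rV[R]_n, (simplex_dot thetaE n), (@simplex R n); split.
    exact: simplex_FUNTF.
  move=> I basI; exists n%:R^-1; split=> //.
  exact: simplex_lower_riesz_constant.
- have thetaE (z : R[i]) :
      `|z| ^+ 2 = z * (Num.conj : involutive_rmorphism R[i]) z := normCK z.
  exists 'rV[R[i]]_n, (simplex_dot thetaE n), (@simplex R[i] n); split.
    exact: simplex_FUNTF.
  move=> I basI; exists n%:R^-1; split.
    exact: simplex_lower_riesz_constant.
  by rewrite -(rmorph_nat (real_complex R)) -fmorphV ltcR.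
Qed.
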